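(* Let $\ell\in\mathbb{N}\cup\{0\}$, $|q|<1$, and $\sigma_{2,\ell}(q)=\sum_{n=0}^{\infty}\frac{(-1)^nq^{n^2+\ell n}}{(-q;q)_n}$. Then \[ \sigma_{2,\ell}(q)=\frac{1}{(-q;q)_{\infty}}\left\{(-q;q)_\ell-\sum_{n=1}^{\infty}(-1)^{n+\ell}q^{\frac{n(5n-1)}{2}+2\ell n}(1+q^{\ell+2n})(q^{n+1};q)_{\ell-1}\sum_{m=0}^{n+\ell-1}\frac{(-1;q)_m}{(q;q)_m}(-q^{-n})^m\right\}. \]
   Context: Notation: $(a;q)_0=1$, $(a;q)_k=\prod_{i=0}^{k-1}(1-aq^i)$ for $k\ge1$, $(a;q)_{-1}=(1-a/q)^{-1}$ (used when $\ell=0$), $(a;q)_\infty=\prod_{i\ge0}(1-aq^i)$. *)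

(* Defs.v *)
From Stdlib Require Import Reals.
From Coquelicot Require Import Coquelicot.

Open Scope C_scope.

(* (a;q)_k *)
Fixpoint qpoch (a q : C) (k : nat) : C :=
  match k with
  | O => 1
  | S j => qpoch a q j * (1 - a * q ^ j)
  end.

(* (a;q)_(k-1), including (a;q)_(-1) = 1 / (1 - a/q) at k = 0 *)
Definition qpoch_pred (a q : C) (k : nat) : C :=
  match k with
  | O => / (1 - a / q)
  | S j => qpoch a q j
  end.

Definition is_Clim_seq (u : nat -> C) (l : C) : Prop :=
  filterlim u eventually (locally l).

(* As with Coquelicot's [RInt], the values of [Clim_seq] and [CSeries] are
   meaningful only when the limit or the sum exists. *)
Definition Clim_seq (u : nat -> C) : C :=
  iota (T := C_CompleteNormedModule) (is_Clim_seq u).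

Definition CSeries (u : nat -> C) : C :=
  iota (T := C_CompleteNormedModule) (is_series u).

(* (a;q)_infinity *)
Definition qpoch_inf (a q : C) : C := Clim_seq (qpoch a q).

Definition sigma2_term (l : nat) (q : C) (n : nat) : C :=
  (- (1)) ^ n * q ^ (n ^ 2 + l * n) / qpoch (- q) q n.

Definition sigma2 (l : nat) (q : C) : C := CSeries (sigma2_term l q).

(* Only used for n >= 1: then the natural-number subtractions do not truncate,
   and n (5n - 1) is even, so the division by 2 is exact.  [sum_n f N] is the
   sum of f m over 0 <= m <= N. *)
Definition rhs_term (l : nat) (q : C) (n : nat) : C :=
  (- (1)) ^ (n + l)
  * q ^ (n * (5 * n - 1) / 2 + 2 * l * n)
  * (1 + q ^ (l + 2 * n))
  * qpoch_pred (q ^ (n + 1)) q l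
  * sum_n (fun m : nat =>
             qpoch (- (1)) q m / qpoch q q m * (- / q ^ n) ^ m)
          (n + l - 1).

(* Main.v *)
(** For fixed n the truncated sum of the theorem is rewritten as a polynomial
    in q^n ([trunc]), which satisfies a first-order recurrence in its length and
    another one under q^n -> q^(n+1).  Creative telescoping then shows that
    R(l) = (-q)_l - (series) satisfies R(l) + R(l+1) + q^(l+1) R(l+2) = 2 S(l+1),
    where S(l) = sum_(n>=0) q^(n(3n-1)/2 + nl) (1 + q^(2n+l)) (-q)_(n+l-1) / (q)_n.
    By a case of Sylvester's identity S(l) = (-q)_inf: a second telescoping gives
    S(l) = S(l+1), and S(l) -> (-q)_inf as l grows.  Multiplying
    sigma_(2,l) + sigma_(2,l+1) + q^(l+1) sigma_(2,l+2) = 2, which is immediate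
    from the series, by (-q)_inf gives the same recurrence.  Since both
    (-q)_inf sigma_(2,l) and R(l) tend to (-q)_inf as l grows, they agree. *)

From Stdlib Require Import Reals Lra Lia.
From Coquelicot Require Import Coquelicot.
Require Import Defs.
Open Scope C_scope.

(** * Algebraic identities *)

Lemma one_sub_mult_pow_neq_0 (a q : C) (n : nat) :
  (Cmod a < 1)%R -> (Cmod q < 1)%R -> 1 - a * q ^ n <> 0.
Proof.
  intros ha hq h.
  assert (e : a * q ^ n = 1).
  { replace (a * q ^ n) with (1 - (1 - a * q ^ n)) by ring. rewrite h. ring. }
  assert (e' : (Cmod (a * q ^ n) = 1)%R) by (rewrite e; apply Cmod_1).
  rewrite Cmod_mult, Cmod_pow in e'.
  assert (Cmod q ^ n <= 1)%R.
  { rewrite <- (pow1 n). apply pow_incr. split; [apply Cmod_ge_0 | lra]. }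
  pose proof (Cmod_ge_0 a). pose proof (pow_le (Cmod q) n (Cmod_ge_0 q)). nra.
Qed.

Lemma one_sub_pow_neq_0 (q : C) (n : nat) :
  (Cmod q < 1)%R -> 1 - q * q ^ n <> 0.
Proof. intros hq. now apply one_sub_mult_pow_neq_0. Qed.

Lemma one_add_pow_neq_0 (q : C) (n : nat) :
  (Cmod q < 1)%R -> 1 - - q * q ^ n <> 0.
Proof. intros hq. apply one_sub_mult_pow_neq_0; [now rewrite Cmod_opp | exact hq]. Qed.

Lemma qpoch_S (a q : C) (k : nat) : qpoch a q (S k) = qpoch a q k * (1 - a * q ^ k).
Proof. reflexivity. Qed.

Lemma qpoch_neq_0_of_lt_1 (a q : C) (n : nat) :
  (Cmod a < 1)%R -> (Cmod q < 1)%R -> qpoch a q n <> 0.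
Proof.
  intros ha hq. induction n as [|n IH]; simpl.
  - apply C1_nz.
  - apply Cmult_neq_0; [exact IH | now apply one_sub_mult_pow_neq_0].
Qed.

Lemma qpoch_neq_0 (q : C) (n : nat) : (Cmod q < 1)%R -> qpoch q q n <> 0.
Proof. intros hq. now apply qpoch_neq_0_of_lt_1. Qed.

Lemma qpoch_opp_neq_0 (q : C) (n : nat) : (Cmod q < 1)%R -> qpoch (- q) q n <> 0.
Proof. intros hq. apply qpoch_neq_0_of_lt_1; [now rewrite Cmod_opp | exact hq]. Qed.

Lemma qpoch_m1_S (q : C) (n : nat) : qpoch (- (1)) q (S n) = 2 * qpoch (- q) q n.
Proof.
  induction n as [|n IH].
  - simpl. ring.
  - change (qpoch (- (1)) q (S (S n)))
      with (qpoch (- (1)) q (S n) * (1 - - (1) * q ^ S n)).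
    rewrite IH. simpl. ring.
Qed.

(* With M = n + l - 1, the truncated sum of the theorem is
   (- q^(-n))^M * trunc q (q^n) M; no negative power of q is left. *)
Fixpoint trunc (q y : C) (M : nat) : C :=
  match M with
  | O => 1
  | S j => - y * trunc q y j + qpoch (- (1)) q (S j) / qpoch q q (S j)
  end.

Lemma trunc_S (q y : C) (M : nat) :
  trunc q y (S M) = - y * trunc q y M + qpoch (- (1)) q (S M) / qpoch q q (S M).
Proof. reflexivity. Qed.

(** Induction on [M] works because both recursive parts pick up the same factor -qy: the weight
    q^(M+1) times -y is q^M times -qy. This is the relation under q^n -> q^(n+1), taken later at y =
    q^k. *)
Lemma trunc_shift (q y : C) (M : nat) : (Cmod q < 1)%R ->
  (1 + q * y) * trunc q (q * y) M + (1 - q * y) * q ^ M * trunc q y M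
  = qpoch (- (1)) q (S M) / qpoch q q M.
Proof.
  intros hq. induction M as [|M IH].
  - simpl. field.
  - rewrite !qpoch_m1_S in *. rewrite !trunc_S, !qpoch_m1_S, !qpoch_S, Cpow_S.
    pose proof (qpoch_neq_0 q M hq). pose proof (one_sub_pow_neq_0 q M hq).
    (* The first summand is -qy times the induction hypothesis; the second collects the new
       coefficient from both truncated sums. *)
    transitivity (- (q * y) * (2 * qpoch (- q) q M / qpoch q q M)
       + ((1 + q * y) + (1 - q * y) * (q * q ^ M))
         * (2 * qpoch (- q) q M / (qpoch q q M * (1 - q * q ^ M)))).
    + rewrite <- IH. field. now split.
    + field. now split.
Qed.

(** The value y = q^0 = 1 is the one met at the lower boundary n = 0 of the telescoping sum, where a
    closed form is required. *)
Lemma trunc_1 (q : C) (M : nat) : (Cmod q < 1)%R ->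
  trunc q 1 M = qpoch (- q) q M / qpoch q q M.
Proof.
  intros hq. induction M as [|M IH].
  - simpl. field.
  - rewrite trunc_S, IH, qpoch_m1_S, !qpoch_S.
    pose proof (qpoch_neq_0 q M hq). pose proof (one_sub_pow_neq_0 q M hq).
    field. now split.
Qed.

(** * Reduced summands and their telescoping certificates *)

Fixpoint tri (n : nat) : nat :=
  match n with O => O | S j => tri j + j end%nat.

(** This is the summand of the theorem at n = k + 1 after the signs and the powers of q^(-n) have
    cancelled; the quotient of q-factorials also covers l = 0. Here [tri n] is n(n-1)/2, given by
    recursion to avoid a division. *)
Definition reduced_rhs_term (q : C) (l k : nat) : C :=
  - (q ^ (tri (S k) + S k * (k + l + 2)) * (1 + q ^ (l + 2 * S k))
     * (qpoch q q (k + l) / qpoch q q (S k)) * trunc q (q ^ S k) (k + l)).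

(* The summand of S(l + 1), so that no index n + l - 1 truncates. *)
Definition sylvester_term (q : C) (l n : nat) : C :=
  q ^ (tri n + n * (n + l + 1)) * (qpoch (- q) q (n + l) / qpoch q q n)
  * (1 + q ^ (2 * n + l + 1)).

(* The summand containing [trunc] comes from q-Gosper summation of its coefficients; the
   other one absorbs the part of the remainder that [sylvester_term] does not account for. *)
Definition reduced_rhs_cert (q : C) (l n : nat) : C :=
  q ^ (tri n + n * (n + l + 5) + 2 * l + 2) / qpoch q q n
  * ((1 - q ^ (n + 1) + q ^ (l + 2 * (n + 1)))
     * (qpoch q q (n + l) * trunc q (q ^ n) (n + l))
     + 2 * q * qpoch (- q) q (n + l)).

Definition sylvester_cert (q : C) (l n : nat) : C :=
  - (q ^ (tri n + n * (n + l + 1) + 3 * n + l + 2) * (qpoch (- q) q (S (n + l)) / qpoch q q n)).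

Lemma Csum_O (f : nat -> C) : sum_n f 0 = f O.
Proof. exact (sum_O f). Qed.

Lemma Csum_Sn (f : nat -> C) (n : nat) : sum_n f (S n) = sum_n f n + f (S n).
Proof. exact (sum_Sn f n). Qed.

(** Compound exponents are broken up until only atoms such as q^k, q^l, q^(k l) and q^(tri k)
    remain, which [field] treats as independent indeterminates. *)
Ltac split_pow :=
  repeat (rewrite Nat.mul_add_distr_l || rewrite Nat.mul_add_distr_r
    || rewrite Nat.mul_succ_l || rewrite Nat.mul_succ_r
    || rewrite Nat.mul_0_l || rewrite Nat.mul_0_r);
  rewrite ?Cpow_add_r, ?Cpow_S, ?Cpow_add_r, ?Cpow_S;
  change (Cpow _ 0) with (RtoC 1).

(** All terms are q-hypergeometric, so after removal of a common factor this is an identity between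
    rational functions of q, q^k and q^l. *)
Lemma sylvester_telescope (q : C) (l k : nat) : (Cmod q < 1)%R ->
  sylvester_term q l (S k) - sylvester_term q (S l) (S k)
  = sylvester_cert q l (S k) - sylvester_cert q l k.
Proof.
  intros hq. unfold sylvester_term, sylvester_cert.
  replace (S k + S l)%nat with (S (S (k + l))) by lia.
  replace (S k + l)%nat with (S (k + l)) by lia.
  rewrite !qpoch_S. cbn [tri].
  pose proof (qpoch_neq_0 q k hq). pose proof (one_sub_pow_neq_0 q k hq).
  split_pow. field. now split.
Qed.

(** The truncated sums keep this from being purely hypergeometric. [trunc_S] brings all of them to
    length k + l, which leaves [u] at q^(k+1) and [v] at q^k, tied to (-q)_(k+l) by
    [trunc_shift]. *)
Lemma reduced_rhs_term_telescope (q : C) (l k : nat) : (Cmod q < 1)%R ->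
  reduced_rhs_term q l k + reduced_rhs_term q (S l) k + q ^ S l * reduced_rhs_term q (S (S l)) k
  = - (2 * sylvester_term q l (S k)) - (reduced_rhs_cert q l (S k) - reduced_rhs_cert q l k).
Proof.
  intros hq. unfold reduced_rhs_term, sylvester_term, reduced_rhs_cert.
  replace (k + S (S l))%nat with (S (S (k + l))) by lia.
  replace (k + S l)%nat with (S (k + l)) by lia.
  replace (S k + l)%nat with (S (k + l)) by lia.
  pose proof (qpoch_neq_0 q k hq). pose proof (one_sub_pow_neq_0 q k hq).
  pose proof (qpoch_neq_0 q (k + l) hq).
  pose proof (one_sub_pow_neq_0 q (k + l) hq) as h1.
  pose proof (one_sub_pow_neq_0 q (S (k + l)) hq) as h2.
  pose proof (trunc_shift q (q ^ k) (k + l) hq) as hs.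
  rewrite qpoch_m1_S in hs.
  rewrite !trunc_S, !qpoch_m1_S, !qpoch_S. cbn [tri].
  rewrite Cpow_S in *.
  set (u := trunc q (q * q ^ k) (k + l)) in *.
  set (v := trunc q (q ^ k) (k + l)) in *.
  rewrite Cpow_add_r in h1, h2, hs.
  split_pow.
  set (X := q ^ l) in *. set (Y := q ^ k) in *.
  set (W := q ^ tri k). set (V := q ^ (k * k)). set (U := q ^ (k * l)).
  set (A := qpoch q q (k + l)) in *. set (B := qpoch (- q) q (k + l)) in *.
  set (D := qpoch q q k) in *.
  (* Solving the shift relation for [B] divides only by 2, whereas solving for [v] would divide by
     powers of q. What remains holds with [u] and [v] as independent unknowns. *)
  assert (hB : B = A * ((1 + q * Y) * u + (1 - q * Y) * (Y * X) * v) / 2)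
    by (rewrite hs; field; assumption).
  clearbody B u v A D X Y U V W. clear hs. subst B.
  field. repeat split; assumption.
Qed.

(** * From the summand of the theorem to its reduced form *)

Lemma qpoch_pow_mult (q : C) (n j : nat) :
  qpoch (q ^ (n + 1)) q j * qpoch q q n = qpoch q q (n + j).
Proof.
  induction j as [|j IH].
  - rewrite Nat.add_0_r. simpl. ring.
  - replace (n + S j)%nat with (S (n + j)) by lia.
    rewrite !qpoch_S, <- IH, !Cpow_add_r, Cpow_1_r. ring.
Qed.

Lemma rhs_term_S (q : C) (l k : nat) : (Cmod q < 1)%R ->
  rhs_term l q (S k) = reduced_rhs_term q l k.
Proof.
  intros hq. unfold rhs_term, reduced_rhs_term.
  assert (he : (S k * (5 * S k - 1) / 2 + 2 * l * S k
                = tri (S k) + S k * (k + l + 2) + S k * (k + l))%nat).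
  (* For n >= 1, n(5n-1)/2 = n(n-1)/2 + 2n^2, which turns the exact division into [tri]. *)
  { assert (ht : forall n, (S n * (5 * S n - 1) / 2 = tri (S n) + 2 * (S n * S n))%nat).
    { intros n. assert (ht : (2 * tri (S n) = S n * n)%nat).
      { induction n as [|n IH]; [reflexivity|].
        change (tri (S (S n))) with (tri (S n) + S n)%nat. lia. }
      symmetry. apply Nat.div_unique_exact; nia. }
    rewrite ht. nia. }
  rewrite he. clear he.
  (* At q = 0 the inverses of q and q^n are mere default values, but both sides carry a positive
     power of q and vanish. *)
  destruct (Ceq_dec q 0) as [->|q0].
  { cbn [tri Nat.mul Nat.add].
    replace (k + l + 2 + k * (k + l + 2))%nat with (S (k + l + 1 + k * (k + l + 2))) by lia.
    rewrite !Cpow_add_r, !Cpow_S. ring. }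
  set (n := S k).
  assert (hy : q ^ n <> 0) by now apply Cpow_nz.
  replace (n + l - 1)%nat with (k + l)%nat by (unfold n; lia).
  (* Pulling out the highest power of -1/y reverses the sum into Horner form in -y, which is
     [trunc]. *)
  assert (hs : forall (y : C) M, y <> 0 ->
    sum_n (fun m : nat => qpoch (- (1)) q m / qpoch q q m * (- / y) ^ m) M
    = (- / y) ^ M * trunc q y M :> C).
  { intros y M y0. induction M as [|M IH].
    - rewrite Csum_O. simpl. field.
    - rewrite Csum_Sn, IH, trunc_S, Cpow_S.
      field. split; [now apply qpoch_neq_0 | assumption]. }
  rewrite hs by assumption.
  assert (hp : qpoch_pred (q ^ (n + 1)) q l = qpoch q q (k + l) / qpoch q q n).
  { pose proof (qpoch_neq_0 q n hq) as hn. unfold n in *.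
    (* For l = 0 the convention for index -1 gives 1/(1 - q^n), which is (q)_(n-1)/(q)_n. *)
    destruct l as [|l]; cbn [qpoch_pred].
    - rewrite qpoch_S in *. rewrite Nat.add_0_r, Nat.add_1_r, !Cpow_S.
      pose proof (one_sub_pow_neq_0 q k hq). pose proof (qpoch_neq_0 q k hq).
      field. repeat split; try assumption.
    - replace (k + S l)%nat with (S k + l)%nat by lia.
      rewrite <- (qpoch_pow_mult q (S k) l). field. exact hn. }
  rewrite hp.
  replace ((- / q ^ n) ^ (k + l)) with ((- (1)) ^ (k + l) * / (q ^ (n * (k + l)))).
  2:{ rewrite Cpow_mult_r, <- Cpow_inv by assumption.
      rewrite <- Cpow_mult_l. f_equal. ring. }
  (* The exponents n + l and n + l - 1 have opposite parity; this is the minus sign in front of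
     [reduced_rhs_term]. *)
  assert (hm : (- (1)) ^ (n + l) * (- (1)) ^ (k + l) = - (1)).
  { unfold n. change (S k + l)%nat with (S (k + l)). rewrite Cpow_S.
    rewrite <- Cmult_assoc, <- Cpow_mult_l.
    replace (- (1) * - (1)) with (RtoC 1) by ring. rewrite Cpow_1_l. ring. }
  rewrite (Cpow_add_r q _ (n * (k + l))).
  assert (q ^ (n * (k + l)) <> 0) by now apply Cpow_nz.
  pose proof (qpoch_neq_0 q n hq).
  transitivity ((- (1)) ^ (n + l) * (- (1)) ^ (k + l) *
    (q ^ (tri n + n * (k + l + 2)) * (1 + q ^ (l + 2 * n))
     * (qpoch q q (k + l) / qpoch q q n) * trunc q (q ^ n) (k + l))).
  - field. now split.
  - rewrite hm. ring.
Qed.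

(** * Series and geometric bounds *)

Lemma pow_le_pow_of_le_1 (r : R) (m n : nat) :
  (0 <= r < 1)%R -> (m <= n)%nat -> (r ^ n <= r ^ m)%R.
Proof.
  intros hr h. replace n with (m + (n - m))%nat by lia. rewrite pow_add.
  assert (0 <= r ^ m)%R by (apply pow_le; lra).
  assert (r ^ (n - m) <= 1)%R.
  { rewrite <- (pow1 (n - m)). apply pow_incr. lra. }
  nra.
Qed.

Lemma is_lim_seq_scal_geom (B r : R) :
  (0 <= r < 1)%R -> is_lim_seq (fun n => (B * r ^ n)%R) 0.
Proof.
  intros hr. rewrite <- (Rmult_0_r B).
  apply (is_lim_seq_scal_l _ B 0), is_lim_seq_geom. rewrite Rabs_pos_eq; lra.
Qed.

Lemma eq_0_of_geometric_bound (x : C) (B r : R) :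
  (0 <= r < 1)%R -> (forall n, (Cmod x <= B * r ^ n)%R) -> x = 0.
Proof.
  intros hr h. apply Cmod_eq_0, Rle_antisym; [|apply Cmod_ge_0].
  pose proof (is_lim_seq_scal_geom B r hr) as hl.
  exact (is_lim_seq_le _ _ (Cmod x) 0 h (is_lim_seq_const _) hl).
Qed.

Lemma Clim_seq_of_geometric_bound (u : nat -> C) (l : C) (B r : R) :
  (0 <= r < 1)%R -> (forall n, (Cmod (u n - l) <= B * r ^ n)%R) -> is_Clim_seq u l.
Proof.
  intros hr h. unfold is_Clim_seq.
  apply (filterlim_locally_ball_norm (K := C_AbsRing) (U := C_NormedModule)).
  intros eps.
  pose proof (is_lim_seq_scal_geom B r hr) as hl. apply is_lim_seq_spec in hl.
  destruct (hl eps) as [N hN]. exists N. intros n hn. specialize (hN n hn).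
  change (Cmod (u n - l) < eps)%R.
  rewrite Rminus_0_r in hN. apply Rle_lt_trans with (2 := hN).
  apply Rle_trans with (2 := Rle_abs _). apply h.
Qed.

Lemma Clim_seq_unique (u : nat -> C) (l : C) : is_Clim_seq u l -> Clim_seq u = l.
Proof.
  exact (iota_filterlim_locally (V := C_CompleteNormedModule) u l).
Qed.

Lemma CSeries_unique (f : nat -> C) (s : C) : is_series f s -> CSeries f = s.
Proof.
  exact (iota_filterlim_locally (V := C_CompleteNormedModule) (sum_n f) s).
Qed.

Lemma CSeries_correct (f : nat -> C) : ex_series f -> is_series f (CSeries f).
Proof. intros [s hs]. now rewrite (CSeries_unique f s hs). Qed.

Lemma CSeries_ext (f g : nat -> C) :
  ex_series f -> (forall n, f n = g n) -> CSeries f = CSeries g.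
Proof.
  intros hf h. symmetry. apply CSeries_unique.
  apply (is_series_ext f); [exact h | now apply CSeries_correct].
Qed.

Lemma CSeries_plus (f g : nat -> C) : ex_series f -> ex_series g ->
  CSeries (fun n => f n + g n) = CSeries f + CSeries g.
Proof.
  intros hf hg. apply CSeries_unique.
  exact (is_series_plus _ _ _ _ (CSeries_correct f hf) (CSeries_correct g hg)).
Qed.

Lemma CSeries_scal (c : C) (f : nat -> C) : ex_series f ->
  CSeries (fun n => c * f n) = c * CSeries f.
Proof.
  intros hf. apply CSeries_unique.
  exact (is_series_scal c _ _ (CSeries_correct f hf)).
Qed.

Lemma ex_series_Cplus (f g : nat -> C) : ex_series f -> ex_series g ->
  ex_series (fun n => f n + g n).
Proof. exact (ex_series_plus f g). Qed.

Lemma ex_series_Cscal (c : C) (f : nat -> C) : ex_series f ->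
  ex_series (fun n => c * f n).
Proof. exact (ex_series_scal c f). Qed.

Lemma ex_series_Cshift (f : nat -> C) : ex_series f -> ex_series (fun k => f (S k)).
Proof. exact (proj1 (ex_series_incr_1 (V := C_NormedModule) f)). Qed.

Lemma CSeries_incr_1 (f : nat -> C) : ex_series f ->
  CSeries f = f O + CSeries (fun k => f (S k)).
Proof.
  intros hf. apply CSeries_unique, (is_series_decr_1 (K := C_AbsRing) (V := C_NormedModule)).
  match goal with |- is_series _ ?l => replace l with (CSeries (fun k => f (S k))) end.
  - apply CSeries_correct. now apply ex_series_Cshift.
  - change (CSeries (fun k => f (S k)) = f O + CSeries (fun k => f (S k)) + - f O). ring.
Qed.

Lemma ex_series_of_geometric_bound (f : nat -> C) (B r : R) :
  (0 <= r < 1)%R -> (forall n, (Cmod (f n) <= B * r ^ n)%R) -> ex_series f.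
Proof.
  intros hr h.
  apply (ex_series_le (V := C_CompleteNormedModule)) with (b := fun n => (B * r ^ n)%R).
  - intros n. change (norm (f n)) with (Cmod (f n)). apply h.
  - apply (ex_series_scal_l (V := R_NormedModule) B), ex_series_geom.
    rewrite Rabs_pos_eq; lra.
Qed.

Lemma sum_n_geometric_le (r : R) (n : nat) :
  (0 <= r < 1)%R -> (sum_n (fun k => r ^ k) n <= / (1 - r))%R.
Proof.
  intros hr. rewrite sum_n_Reals, tech3 by lra.
  assert (0 <= r ^ S n)%R by (apply pow_le; lra).
  unfold Rdiv. assert (0 < / (1 - r))%R by (apply Rinv_0_lt_compat; lra). nra.
Qed.

Lemma Cmod_sum_n_le (f : nat -> C) (B r : R) (n : nat) :
  (0 <= r < 1)%R -> (forall n, (Cmod (f n) <= B * r ^ n)%R) ->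
  (Cmod (sum_n f n) <= B / (1 - r))%R.
Proof.
  intros hr h.
  assert (hB : (0 <= B)%R).
  { specialize (h O). pose proof (Cmod_ge_0 (f O)). simpl in h. lra. }
  apply Rle_trans with (B * sum_n (fun k => r ^ k) n)%R.
  - induction n as [|n IH].
    + rewrite !sum_O. apply h.
    + rewrite !sum_Sn. apply Rle_trans with (1 := Cmod_triangle _ _).
      specialize (h (S n)). change (@plus R_AbelianMonoid) with Rplus. lra.
  - apply Rmult_le_compat_l; [exact hB|]. now apply sum_n_geometric_le.
Qed.

Lemma Cmod_series_le (f : nat -> C) (s : C) (B r : R) :
  (0 <= r < 1)%R -> (forall n, (Cmod (f n) <= B * r ^ n)%R) ->
  is_series f s -> (Cmod s <= B / (1 - r))%R.
Proof.
  intros hr h hs.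
  apply (is_lim_seq_le (fun n => Cmod (sum_n f n)) (fun _ => (B / (1 - r))%R)
           (Cmod s) (B / (1 - r))%R).
  - intros n. now apply Cmod_sum_n_le.
  - exact (filterlim_comp _ _ _ (sum_n f) norm _ _ _ hs (filterlim_norm (V := C_NormedModule) s)).
  - apply is_lim_seq_const.
Qed.

(** Partial sums collapse to G(n+1) - G(0), and the first term tends to 0. The bound concerns
    successors only, since the certificate estimates are made away from the boundary index 0. *)
Lemma is_series_telescope (G : nat -> C) (B r : R) :
  (0 <= r < 1)%R -> (forall n, (Cmod (G (S n)) <= B * r ^ n)%R) ->
  is_series (fun k => G (S k) - G k) (- G O).
Proof.
  intros hr h.
  apply (Clim_seq_of_geometric_bound (sum_n (fun k => G (S k) - G k)) (- G O) B r hr).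
  intros n.
  replace (sum_n (fun k => G (S k) - G k) n) with (G (S n) - G O).
  - replace (G (S n) - G O - - G O) with (G (S n)) by ring. apply h.
  - induction n as [|n IH].
    + now rewrite Csum_O.
    + rewrite Csum_Sn, <- IH. ring.
Qed.

(** * Uniqueness for the recurrence in l *)

Lemma exp_le_exp (x y : R) : (x <= y -> exp x <= exp y)%R.
Proof. intros [h | ->]; [left; now apply exp_increasing | right; reflexivity]. Qed.

(* Iterating the recurrence n times costs at most the factor
   prod_(j >= l) (1 + r^j) <= exp (r^l / (1 - r)), whereas D(l + n) = O(r^n). *)
Lemma recurrence_unique (q : C) (D : nat -> C) (B : R) : (Cmod q < 1)%R ->
  (forall l, D l + D (S l) + q ^ S l * D (S (S l)) = 0) ->
  (forall l, (Cmod (D l) <= B * Cmod q ^ l)%R) ->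
  forall l, D l = 0.
Proof.
  intros hq hrec hB. set (r := Cmod q) in *.
  assert (hr : (0 <= r < 1)%R) by (split; [apply Cmod_ge_0 | exact hq]).
  assert (hB0 : (0 <= B)%R).
  { specialize (hB O). pose proof (Cmod_ge_0 (D O)). simpl in hB. lra. }
  (* Each use of the recurrence gains a power of r, while the exponential factor does not depend on
     [n]; letting [n] grow then forces D(l) = 0. *)
  assert (key : forall n l, (Cmod (D l) <= B * r ^ (l + n) * exp (r ^ l / (1 - r)))%R).
  { induction n as [|n IH]; intros l.
    - rewrite Nat.add_0_r. apply Rle_trans with (1 := hB l).
      assert (0 <= r ^ l)%R by (apply pow_le; lra).
      assert (0 <= r ^ l / (1 - r))%R.
      { apply Rmult_le_pos; [assumption|]. left. apply Rinv_0_lt_compat. lra. }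
      pose proof (exp_ineq1_le (r ^ l / (1 - r))).
      assert (0 <= B * r ^ l)%R by now apply Rmult_le_pos. nra.
    - assert (hD : D l = - D (S l) + - (q ^ S l * D (S (S l)))).
      { replace (D l) with (D l + D (S l) + q ^ S l * D (S (S l))
          - D (S l) - q ^ S l * D (S (S l))) by ring. rewrite hrec. ring. }
      rewrite hD. apply Rle_trans with (1 := Cmod_triangle _ _).
      rewrite !Cmod_opp, Cmod_mult, Cmod_pow. fold r.
      pose proof (IH (S l)) as h1. pose proof (IH (S (S l))) as h2.
      set (e := exp (r ^ S l / (1 - r))) in *.
      assert (he : (exp (r ^ S (S l) / (1 - r)) <= e)%R).
      { apply exp_le_exp. apply Rmult_le_compat_r.
        - left. apply Rinv_0_lt_compat. lra.
        - apply pow_le_pow_of_le_1; [exact hr|lia]. }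
      assert (hp : (0 <= r ^ (l + S n))%R) by (apply pow_le; lra).
      replace (S l + n)%nat with (l + S n)%nat in h1 by lia.
      replace (S (S l) + n)%nat with (S (l + S n)) in h2 by lia.
      assert (hl : (0 <= r ^ l)%R) by (apply pow_le; lra).
      (* The exponent r^l/(1-r) splits as r^l + r^(l+1)/(1-r), and its first part absorbs 1 +
         r^l. *)
      assert (hE : ((1 + r ^ l) * e <= exp (r ^ l / (1 - r)))%R).
      { replace (r ^ l / (1 - r))%R with (r ^ l + r ^ S l / (1 - r))%R
          by (simpl; field; lra).
        rewrite exp_plus. apply Rmult_le_compat_r; [left; apply exp_pos|].
        apply exp_ineq1_le. }
      assert (he0 : (0 < e)%R) by apply exp_pos.
      assert (h3 : (Cmod (D (S (S l))) <= B * r ^ (l + S n) * e)%R).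
      { apply Rle_trans with (1 := h2).
        assert (0 <= B * r ^ (l + S n))%R by now apply Rmult_le_pos.
        apply Rmult_le_compat; [| left; apply exp_pos | | exact he].
        - apply Rmult_le_pos; [exact hB0 | apply pow_le; lra].
        - apply Rmult_le_compat_l; [exact hB0|].
          apply pow_le_pow_of_le_1; [exact hr | lia]. }
      assert (h4 : (r ^ S l <= r ^ l)%R) by (apply pow_le_pow_of_le_1; [exact hr | lia]).
      assert (h5 : (0 <= r ^ S l)%R) by (apply pow_le; lra).
      pose proof (Cmod_ge_0 (D (S (S l)))).
      apply Rle_trans with (B * r ^ (l + S n) * ((1 + r ^ l) * e))%R.
      + assert (r ^ S l * Cmod (D (S (S l))) <= r ^ l * (B * r ^ (l + S n) * e))%R
          by now apply Rmult_le_compat. lra.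
      + apply Rmult_le_compat_l; [now apply Rmult_le_pos | exact hE]. }
  intros l. apply eq_0_of_geometric_bound with (B * r ^ l * exp (r ^ l / (1 - r)))%R r;
    [exact hr|].
  intros n. apply Rle_trans with (1 := key n l). rewrite pow_add. right. ring.
Qed.

(** * Uniform bounds for q-Pochhammer symbols and their inverses *)

Lemma Cmod_qpoch_le (a q : C) (k : nat) : (Cmod q < 1)%R ->
  (Cmod (qpoch a q k) <= exp (Cmod a / (1 - Cmod q)))%R.
Proof.
  intros hq. pose proof (Cmod_ge_0 q). pose proof (Cmod_ge_0 a).
  assert (hi : (0 < / (1 - Cmod q))%R) by (apply Rinv_0_lt_compat; lra).
  (* Each factor is at most 1 + |a||q|^i <= exp(|a||q|^i). The partial geometric sum is kept in the
     exponent so that the induction closes. *)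
  apply Rle_trans with (exp (Cmod a * (1 - Cmod q ^ k) / (1 - Cmod q)))%R.
  - induction k as [|k IH].
    + simpl. replace (Cmod a * (1 - 1) / (1 - Cmod q))%R with 0%R by (field; lra).
      rewrite exp_0, Cmod_1. lra.
    + rewrite qpoch_S, Cmod_mult.
      replace (Cmod a * (1 - Cmod q ^ S k) / (1 - Cmod q))%R
        with (Cmod a * (1 - Cmod q ^ k) / (1 - Cmod q) + Cmod a * Cmod q ^ k)%R
        by (simpl; field; lra).
      rewrite exp_plus. apply Rmult_le_compat; try apply Cmod_ge_0; [exact IH|].
      apply Rle_trans with (1 := Cmod_triangle _ _).
      rewrite Cmod_1, Cmod_opp, Cmod_mult, Cmod_pow. apply exp_ineq1_le.
  - apply exp_le_exp. unfold Rdiv. apply Rmult_le_compat_r; [lra|].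
    assert (0 <= Cmod q ^ k)%R by now apply pow_le. nra.
Qed.

Lemma Cmod_qpoch_ge (a q : C) (k : nat) : (Cmod q < 1)%R -> (Cmod a <= Cmod q)%R ->
  (exp (- (/ (1 - Cmod q)) ^ 2) <= Cmod (qpoch a q k))%R.
Proof.
  intros hq haq. pose proof (Cmod_ge_0 q). pose proof (Cmod_ge_0 a).
  set (r := Cmod q) in *.
  assert (hi : (0 < / (1 - r))%R) by (apply Rinv_0_lt_compat; lra).
  (* With r = |q|, the factor of index i is at least exp(-r^i/(1-r)); summing these exponents for i
     < k gives (1-r^k)/(1-r)^2. *)
  apply Rle_trans with (exp (- ((1 - r ^ k) * (/ (1 - r)) ^ 2)))%R.
  - apply exp_le_exp. assert (0 <= r ^ k)%R by now apply pow_le.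
    assert (0 <= (/ (1 - r)) ^ 2)%R by (apply pow_le; lra). nra.
  - induction k as [|k IH].
    + simpl. rewrite Cmod_1. right. rewrite <- exp_0. f_equal. ring.
    + rewrite qpoch_S, Cmod_mult.
      assert (hk : (0 <= r ^ k <= 1)%R).
      { split; [now apply pow_le|]. rewrite <- (pow1 k). apply pow_incr. lra. }
      replace (- ((1 - r ^ S k) * (/ (1 - r)) ^ 2))%R
        with (- ((1 - r ^ k) * (/ (1 - r)) ^ 2) + - (r ^ k * / (1 - r)))%R
        by (simpl; field; lra).
      rewrite exp_plus. apply Rmult_le_compat; try (left; apply exp_pos); [exact IH|].
      set (t := Cmod (a * q ^ k)).
      assert (ht : (0 <= t /\ t <= r ^ k /\ t <= r)%R).
      { split; [apply Cmod_ge_0|].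
        unfold t. rewrite Cmod_mult, Cmod_pow. fold r. nra. }
      (* For 0 <= t <= r, 1 - t >= exp(-t/(1-r)), because (1 + t/(1-r))(1-t) = 1 + t(r-t)/(1-r) >=
         1. *)
      apply Rle_trans with (1 - t)%R.
      * rewrite exp_Ropp. apply Rle_trans with (/ (1 + t * / (1 - r)))%R.
        -- apply Rinv_le_contravar; [nra|].
           apply Rle_trans with (2 := exp_ineq1_le _). nra.
        -- apply Rmult_le_reg_l with (1 + t * / (1 - r))%R; [nra|].
           rewrite Rinv_r by nra.
           replace ((1 + t * / (1 - r)) * (1 - t))%R
             with (1 + t * ((r - t) * / (1 - r)))%R by (field; lra).
           assert (0 <= (r - t) * / (1 - r))%R by nra. nra.
      * pose proof (Cmod_triangle (1 - a * q ^ k) (a * q ^ k)) as h.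
        replace (1 - a * q ^ k + a * q ^ k) with (RtoC 1) in h by ring.
        rewrite Cmod_1 in h. fold t in h. lra.
Qed.

Lemma qpoch_bounds (q : C) : (Cmod q < 1)%R -> exists K : R, (1 <= K)%R /\
  forall k, (Cmod (qpoch q q k) <= K)%R /\ (Cmod (qpoch (- q) q k) <= K)%R /\
    (Cmod (qpoch (- (1)) q k) <= K)%R /\
    (Cmod (/ qpoch q q k) <= K)%R /\ (Cmod (/ qpoch (- q) q k) <= K)%R.
Proof.
  intros hq. pose proof (Cmod_ge_0 q).
  assert (hi : (0 < / (1 - Cmod q))%R) by (apply Rinv_0_lt_compat; lra).
  assert (h1 : (1 <= / (1 - Cmod q))%R).
  { rewrite <- Rinv_1. apply Rinv_le_contravar; lra. }
  (* The constant is dictated by the lower bound; it also dominates exp(|a|/(1-|q|)), as |a| <= 1 <=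
     1/(1-|q|). *)
  exists (exp ((/ (1 - Cmod q)) ^ 2)).
  split.
  { apply Rle_trans with (2 := exp_ineq1_le _). nra. }
  assert (hu : forall a k, (Cmod a <= 1)%R ->
    (Cmod (qpoch a q k) <= exp ((/ (1 - Cmod q)) ^ 2))%R).
  { intros a k ha. apply Rle_trans with (1 := Cmod_qpoch_le a q k hq).
    apply exp_le_exp. pose proof (Cmod_ge_0 a). unfold Rdiv. simpl. nra. }
  assert (hl : forall a k, (Cmod a <= Cmod q)%R -> qpoch a q k <> 0 ->
    (Cmod (/ qpoch a q k) <= exp ((/ (1 - Cmod q)) ^ 2))%R).
  { intros a k ha h0. rewrite Cmod_inv by exact h0.
    rewrite <- (Ropp_involutive ((/ (1 - Cmod q)) ^ 2)), exp_Ropp.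
    apply Rinv_le_contravar; [apply exp_pos|]. now apply Cmod_qpoch_ge. }
  intros k. repeat split.
  - apply hu. lra.
  - apply hu. rewrite Cmod_opp. lra.
  - apply hu. rewrite Cmod_m1. lra.
  - apply hl; [lra | now apply qpoch_neq_0].
  - apply hl; [rewrite Cmod_opp; lra | now apply qpoch_opp_neq_0].
Qed.

(** * The two sides *)

(** K/(1-|q|) is the fixed point of x -> |q| x + K, so the recursion of [trunc] preserves the
    bound. *)
Lemma Cmod_trunc_le (q y : C) (K : R) (M : nat) :
  (Cmod q < 1)%R -> (Cmod y <= Cmod q)%R -> (1 <= K)%R ->
  (forall k, (Cmod (qpoch (- (1)) q k / qpoch q q k) <= K)%R) ->
  (Cmod (trunc q y M) <= K / (1 - Cmod q))%R.
Proof.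
  intros hq hy hK h. pose proof (Cmod_ge_0 q).
  assert (hi : (0 < / (1 - Cmod q))%R) by (apply Rinv_0_lt_compat; lra).
  assert (hd : (K / (1 - Cmod q) = Cmod q * (K / (1 - Cmod q)) + K)%R) by (field; lra).
  assert (hp : (0 <= K / (1 - Cmod q))%R) by (apply Rmult_le_pos; lra).
  induction M as [|M IH].
  - simpl. rewrite Cmod_1. rewrite hd. nra.
  - rewrite trunc_S. apply Rle_trans with (1 := Cmod_triangle _ _).
    rewrite Cmod_mult, Cmod_opp, hd. apply Rplus_le_compat; [|apply h].
    apply Rmult_le_compat; try apply Cmod_ge_0; assumption.
Qed.

Lemma Cmod_pow_mult_le (q x : C) (m n : nat) (B : R) : (Cmod q < 1)%R ->
  (m <= n)%nat -> (Cmod x <= B)%R -> (Cmod (q ^ n * x) <= B * Cmod q ^ m)%R.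
Proof.
  intros hq hmn hx. rewrite Cmod_mult, Cmod_pow, Rmult_comm.
  apply Rmult_le_compat; try apply Cmod_ge_0; [apply pow_le, Cmod_ge_0 | exact hx|].
  apply pow_le_pow_of_le_1; [split; [apply Cmod_ge_0 | exact hq] | exact hmn].
Qed.

Lemma Cmod_mult_le (x y : C) (A B : R) :
  (Cmod x <= A)%R -> (Cmod y <= B)%R -> (Cmod (x * y) <= A * B)%R.
Proof.
  intros hx hy. rewrite Cmod_mult. apply Rmult_le_compat; try apply Cmod_ge_0; assumption.
Qed.

Lemma Cmod_plus_le (x y : C) (A B : R) :
  (Cmod x <= A)%R -> (Cmod y <= B)%R -> (Cmod (x + y) <= A + B)%R.
Proof. intros hx hy. apply Rle_trans with (1 := Cmod_triangle x y). lra. Qed.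

Lemma Cmod_pow_le_1 (q : C) (n : nat) : (Cmod q < 1)%R -> (Cmod (q ^ n) <= 1)%R.
Proof.
  intros hq. rewrite Cmod_pow, <- (pow1 n). apply pow_incr.
  split; [apply Cmod_ge_0 | lra].
Qed.

(** The quadratic exponents of q dominate k + l, or k for the certificates, and the cofactors are
    bounded uniformly. Decay in l serves the limits l -> infinity; the certificates only have to
    vanish as k grows. *)
Lemma term_bounds (q : C) : (Cmod q < 1)%R -> exists B : R, forall l k,
  (Cmod (reduced_rhs_term q l k) <= B * Cmod q ^ (k + l))%R /\
  (Cmod (sylvester_term q l (S k)) <= B * Cmod q ^ (k + l))%R /\
  (Cmod (reduced_rhs_cert q l (S k)) <= B * Cmod q ^ k)%R /\
  (Cmod (sylvester_cert q l (S k)) <= B * Cmod q ^ k)%R /\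
  (Cmod (sigma2_term l q (S k)) <= B * Cmod q ^ (k + l))%R.
Proof.
  intros hq. destruct (qpoch_bounds q hq) as [K [hK hb]].
  set (r := Cmod q) in *. pose proof (Cmod_ge_0 q) as hr0. fold r in hr0.
  set (L := (K * K / (1 - r))%R).
  assert (hi : (0 < / (1 - r))%R) by (apply Rinv_0_lt_compat; lra).
  assert (hL : (0 <= L)%R) by (apply Rmult_le_pos; nra).
  assert (hdiv : forall x y : C, (Cmod x <= K)%R -> (Cmod (/ y) <= K)%R ->
    (Cmod (x / y) <= K * K)%R) by (intros; now apply Cmod_mult_le).
  assert (hu : forall k M, (Cmod (trunc q (q ^ S k) M) <= L)%R).
  { intros k M. apply Cmod_trunc_le; [exact hq | | nra |].
    - rewrite Cpow_S, Cmod_mult. pose proof (Cmod_pow_le_1 q k hq).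
      pose proof (Cmod_ge_0 (q ^ k)). fold r. nra.
    - intros j. apply hdiv; apply hb. }
  assert (hone : forall n, (Cmod (1 + q ^ n) <= 2)%R).
  { intros n. replace 2%R with (1 + 1)%R by ring.
    apply Cmod_plus_le; [rewrite Cmod_1; lra | now apply Cmod_pow_le_1]. }
  (* These bound the cofactors left once the power of q is split off: [B1] for [reduced_rhs_term],
     [B3] for its certificate, [B2] for the other three. *)
  set (B1 := (2 * (K * K) * L)%R). set (B2 := (K * K * 2)%R).
  set (B3 := (K * (3 * (K * L) + 2 * K))%R).
  assert (hB1 : (0 <= B1)%R) by (unfold B1; apply Rmult_le_pos; nra).
  assert (hB2 : (0 <= B2)%R) by (unfold B2; nra).
  assert (hB3 : (0 <= B3)%R).
  { unfold B3. assert (0 <= K * L)%R by (apply Rmult_le_pos; lra).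
    apply Rmult_le_pos; lra. }
  exists (B1 + B2 + B3)%R. intros l k.
  assert (hw : forall (B : R) x (n : nat), (B <= B1 + B2 + B3)%R -> (x <= B * r ^ n)%R ->
     (x <= (B1 + B2 + B3) * r ^ n)%R).
  { intros B x n h1 h2. assert (0 <= r ^ n)%R by now apply pow_le. nra. }
  split; [|split; [|split; [|split]]].
  - apply (hw B1); [lra|]. unfold reduced_rhs_term. rewrite Cmod_opp, <- !Cmult_assoc.
    apply Cmod_pow_mult_le; [exact hq | cbn [tri]; nia|].
    unfold B1. rewrite Rmult_assoc. apply Cmod_mult_le; [apply hone|].
    apply Cmod_mult_le; [apply hdiv; apply hb | apply hu].
  - apply (hw B2); [lra|]. unfold sylvester_term. rewrite <- !Cmult_assoc.
    apply Cmod_pow_mult_le; [exact hq | cbn [tri]; nia|].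
    apply Cmod_mult_le; [apply hdiv; apply hb | apply hone].
  - apply (hw B3); [lra|]. unfold reduced_rhs_cert, Cdiv. rewrite <- !Cmult_assoc.
    apply Cmod_pow_mult_le; [exact hq | cbn [tri]; nia|].
    unfold B3. apply Cmod_mult_le; [apply hb|].
    apply Cmod_plus_le; apply Cmod_mult_le.
    + replace 3%R with (1 + 1 + 1)%R by ring. unfold Cminus.
      repeat apply Cmod_plus_le; rewrite ?Cmod_opp, ?Cmod_1;
        try (now apply Cmod_pow_le_1); lra.
    + apply Cmod_mult_le; [apply hb | apply hu].
    + rewrite Cmod_R, Rabs_pos_eq; lra.
    + replace K with (1 * K)%R by ring. apply Cmod_mult_le; [fold r; lra | apply hb].
  - apply (hw B2); [lra|]. unfold sylvester_cert. rewrite Cmod_opp.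
    apply Cmod_pow_mult_le; [exact hq | cbn [tri]; nia|].
    apply Rle_trans with (K * K)%R; [apply hdiv; apply hb | unfold B2; nra].
  - apply (hw B2); [lra|]. unfold sigma2_term.
    replace ((- (1)) ^ S k * q ^ (S k ^ 2 + l * S k) / qpoch (- q) q (S k))
      with (q ^ (S k ^ 2 + l * S k) * ((- (1)) ^ S k * / qpoch (- q) q (S k)))
      by (unfold Cdiv; ring).
    apply Cmod_pow_mult_le; [exact hq | simpl; nia|].
    apply Rle_trans with (1 * K)%R; [|unfold B2; nra].
    apply Cmod_mult_le; [|apply hb]. rewrite Cmod_pow, Cmod_m1, pow1. lra.
Qed.

(** The increments q^(l+1) (-q)_l are summable, with tails O(|q|^l). The limit is nonzero because
    the inverses 1/(-q)_n stay bounded. *)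
Lemma qpoch_limit (q : C) : (Cmod q < 1)%R -> exists (P : C) (B : R),
  P <> 0 /\ is_Clim_seq (qpoch (- q) q) P /\
  forall l, (Cmod (qpoch (- q) q l - P) <= B * Cmod q ^ l)%R.
Proof.
  intros hq. destruct (qpoch_bounds q hq) as [K [hK hb]].
  assert (hr : (0 <= Cmod q < 1)%R) by (split; [apply Cmod_ge_0 | exact hq]).
  set (u := qpoch (- q) q) in *.
  set (d := fun l k => u (S (l + k)) - u (l + k)%nat).
  assert (hd : forall l k, (Cmod (d l k) <= K * Cmod q ^ l * Cmod q ^ k)%R).
  { intros l k. unfold d, u. rewrite qpoch_S.
    replace (qpoch (- q) q (l + k) * (1 - - q * q ^ (l + k)) - qpoch (- q) q (l + k))
      with (q ^ S (l + k) * qpoch (- q) q (l + k)) by (rewrite Cpow_S; ring).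
    rewrite Rmult_assoc, <- pow_add.
    apply Cmod_pow_mult_le; [exact hq | lia | apply hb]. }
  assert (hsum : forall l n, sum_n (d l) n = u (S (l + n)) - u l :> C).
  { intros l n. induction n as [|n IH].
    - rewrite Csum_O. unfold d. now rewrite Nat.add_0_r.
    - rewrite Csum_Sn, IH. unfold d. replace (l + S n)%nat with (S (l + n)) by lia. ring. }
  assert (hl : forall l, is_series (d l) (CSeries (d l))).
  { intros l. apply CSeries_correct.
    now apply ex_series_of_geometric_bound with (K * Cmod q ^ l)%R (Cmod q). }
  set (P := u O + CSeries (d O)).
  assert (hP : forall l, CSeries (d l) = P - u l).
  { assert (h : forall l, CSeries (d l) = d l O + CSeries (d (S l))).
    { intros l. rewrite CSeries_incr_1 by (eexists; apply hl). f_equal.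
      apply CSeries_ext.
      - apply ex_series_Cshift. eexists; apply hl.
      - intros n. unfold d. now replace (l + S n)%nat with (S l + n)%nat by lia. }
    induction l as [|l IH].
    - unfold P. ring.
    - replace (CSeries (d (S l))) with (CSeries (d l) - d l O) by (rewrite h; ring).
      rewrite IH. unfold d. rewrite Nat.add_0_r. ring. }
  set (B := (K / (1 - Cmod q))%R).
  assert (hB : forall l, (Cmod (u l - P) <= B * Cmod q ^ l)%R).
  { intros l. replace (u l - P) with (- CSeries (d l)) by (rewrite hP; ring).
    rewrite Cmod_opp.
    apply Rle_trans with (K * Cmod q ^ l / (1 - Cmod q))%R.
    - now apply Cmod_series_le with (d l).
    - right. unfold B. field. lra. }
  exists P, B. split; [|split; [|exact hB]].
  - intros h0.
    (* [u O] is 1. Written as u(n)/u(n), it would be O(|q|^n) if the limit were 0. *)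
    assert (u O = 0); [|now apply (qpoch_opp_neq_0 q 0 hq)].
    apply eq_0_of_geometric_bound with (K * B)%R (Cmod q); [exact hr|]. intros n.
    specialize (hB n). rewrite h0 in hB. replace (u n - 0) with (u n) in hB by ring.
    replace (u O) with (u n * / u n)
      by (unfold u at 3; simpl; field; now apply qpoch_opp_neq_0).
    replace (K * B * Cmod q ^ n)%R with (B * Cmod q ^ n * K)%R by ring.
    apply Cmod_mult_le; [exact hB | apply hb].
  - now apply Clim_seq_of_geometric_bound with B (Cmod q).
Qed.

(** * Recurrences in l for both sides, and the conclusion *)

Lemma sigma2_recurrence (q : C) (l : nat) : (Cmod q < 1)%R ->
  (forall j, ex_series (sigma2_term j q)) ->
  sigma2 l q + sigma2 (S l) q + q ^ S l * sigma2 (S (S l)) q = 2.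
Proof.
  intros hq hex.
  assert (h1 : sigma2 l q + sigma2 (S l) q
     = CSeries (fun n => sigma2_term l q n + sigma2_term (S l) q n)).
  { unfold sigma2. now rewrite CSeries_plus. }
  rewrite h1, CSeries_incr_1 by now apply ex_series_Cplus.
  (* At n + 1 the first two summands add up to a multiple of 1 + q^(n+1), which cancels the last
     factor of (-q)_(n+1). The terms at n = 0 supply the 2. *)
  rewrite (CSeries_ext _ (fun n => - q ^ S l * sigma2_term (S (S l)) q n)).
  - rewrite CSeries_scal by apply hex. unfold sigma2, sigma2_term at 1 2.
    rewrite !Nat.mul_0_r. simpl. field.
  - apply (ex_series_Cshift (fun n => sigma2_term l q n + sigma2_term (S l) q n)).
    now apply ex_series_Cplus.
  - intros n. unfold sigma2_term.
    replace (S n ^ 2 + l * S n)%nat with (n ^ 2 + n + n + 1 + l * n + l)%nat by (simpl; lia).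
    replace (S n ^ 2 + S l * S n)%nat with (n ^ 2 + n + n + 1 + l * n + l + n + 1)%nat
      by (simpl; lia).
    replace (n ^ 2 + S (S l) * n)%nat with (n ^ 2 + n + n + l * n)%nat by (simpl; lia).
    rewrite qpoch_S, !Cpow_add_r, Cpow_1_r, !Cpow_S.
    pose proof (qpoch_opp_neq_0 q n hq). pose proof (one_add_pow_neq_0 q n hq).
    field. split; assumption.
Qed.

(** The summand at n = 0 is (-q)_(l+1), so the left-hand side is the full sum S(l+1). It does not
    depend on l and tends to P as l grows. *)
Lemma sylvester_series (q P : C) (B : R) (l : nat) : (Cmod q < 1)%R ->
  (forall j k, (Cmod (sylvester_term q j (S k)) <= B * Cmod q ^ (k + j))%R) ->
  (forall j k, (Cmod (sylvester_cert q j (S k)) <= B * Cmod q ^ k)%R) ->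
  (forall j, (Cmod (qpoch (- q) q j - P) <= B * Cmod q ^ j)%R) ->
  qpoch (- q) q (S l) + CSeries (fun k => sylvester_term q l (S k)) = P.
Proof.
  intros hq hA hc hP.
  assert (hr : (0 <= Cmod q < 1)%R) by (split; [apply Cmod_ge_0 | exact hq]).
  set (F := fun j => CSeries (fun k => sylvester_term q j (S k))).
  assert (hA' : forall j k,
    (Cmod (sylvester_term q j (S k)) <= B * Cmod q ^ j * Cmod q ^ k)%R).
  { intros j k. rewrite Rmult_assoc, <- pow_add, Nat.add_comm. apply hA. }
  assert (hex : forall j, ex_series (fun k => sylvester_term q j (S k))).
  { intros j. now apply ex_series_of_geometric_bound with (B * Cmod q ^ j)%R (Cmod q). }
  set (D := fun j => qpoch (- q) q (S j) + F j - P).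
  (* The boundary value -[sylvester_cert q j 0] = q^(j+2) (-q)_(j+1) is exactly (-q)_(j+2) -
     (-q)_(j+1). *)
  assert (hD : forall j, D j = D (S j)).
  { intros j.
    assert (h : F j + (-(1)) * F (S j) = - sylvester_cert q j O).
    { unfold F. rewrite <- CSeries_scal, <- CSeries_plus
        by (try apply ex_series_Cscal; apply hex).
      rewrite (CSeries_ext _ (fun k => sylvester_cert q j (S k) - sylvester_cert q j k)).
      - apply CSeries_unique. now apply is_series_telescope with B (Cmod q).
      - apply ex_series_Cplus; [|apply ex_series_Cscal]; apply hex.
      - intros k. rewrite <- sylvester_telescope by exact hq. ring. }
    unfold D. replace (F j) with (F j + (-(1)) * F (S j) + F (S j)) by ring.
    rewrite h. unfold sylvester_cert. cbn [tri Nat.mul Nat.add].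
    rewrite !qpoch_S. split_pow. change (qpoch q q 0) with (RtoC 1). field. }
  assert (hDl : forall n, D l = D (l + n)%nat).
  { induction n as [|n IH]; [now rewrite Nat.add_0_r|].
    rewrite IH, hD. now replace (l + S n)%nat with (S (l + n)) by lia. }
  assert (D l = 0).
  { apply eq_0_of_geometric_bound with (B + B / (1 - Cmod q))%R (Cmod q); [exact hr|].
    intros n. rewrite (hDl n).
    assert (hB : (0 <= B)%R).
    { specialize (hP O). pose proof (Cmod_ge_0 (qpoch (- q) q 0 - P)). simpl in *. lra. }
    assert (hi : (0 <= / (1 - Cmod q))%R) by (left; apply Rinv_0_lt_compat; lra).
    assert (hle : (Cmod q ^ (l + n) <= Cmod q ^ n)%R)
      by (apply pow_le_pow_of_le_1; [exact hr | lia]).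
    assert (hle' : (Cmod q ^ S (l + n) <= Cmod q ^ n)%R)
      by (apply pow_le_pow_of_le_1; [exact hr | lia]).
    replace (D (l + n)%nat) with ((qpoch (- q) q (S (l + n)) - P) + F (l + n)%nat)
      by (unfold D; ring).
    rewrite Rmult_plus_distr_r. apply Cmod_plus_le.
    - apply Rle_trans with (1 := hP _). nra.
    - apply Rle_trans with (B * Cmod q ^ (l + n) / (1 - Cmod q))%R.
      + apply Cmod_series_le with (fun k => sylvester_term q (l + n) (S k));
          [exact hr | apply hA' | apply CSeries_correct, hex].
      + replace (B / (1 - Cmod q) * Cmod q ^ n)%R with (B * Cmod q ^ n * / (1 - Cmod q))%R
          by (unfold Rdiv; ring).
        apply Rmult_le_compat_r; [exact hi|]. now apply Rmult_le_compat_l. }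
  replace (qpoch (- q) q (S l) + CSeries (fun k => sylvester_term q l (S k)))
    with (D l + P) by (unfold D, F; ring).
  rewrite H. ring.
Qed.

Lemma reduced_rhs_term_recurrence (q P : C) (B : R) (l : nat) : (Cmod q < 1)%R ->
  (forall j, ex_series (reduced_rhs_term q j)) ->
  (forall k, (Cmod (reduced_rhs_cert q l (S k)) <= B * Cmod q ^ k)%R) ->
  ex_series (fun k => sylvester_term q l (S k)) ->
  qpoch (- q) q (S l) + CSeries (fun k => sylvester_term q l (S k)) = P ->
  let rhs j := qpoch (- q) q j - CSeries (reduced_rhs_term q j) in
  rhs l + rhs (S l) + q ^ S l * rhs (S (S l)) = 2 * P.
Proof.
  intros hq hex hc hexA hP rhs.
  assert (hr : (0 <= Cmod q < 1)%R) by (split; [apply Cmod_ge_0 | exact hq]).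
  assert (h : CSeries (reduced_rhs_term q l) + CSeries (reduced_rhs_term q (S l))
      + q ^ S l * CSeries (reduced_rhs_term q (S (S l)))
      + 2 * CSeries (fun k => sylvester_term q l (S k)) = reduced_rhs_cert q l O).
  { rewrite <- (CSeries_scal 2), <- (CSeries_scal (q ^ S l)) by auto.
    rewrite <- !CSeries_plus
      by (repeat apply ex_series_Cplus; try apply ex_series_Cscal; auto).
    apply CSeries_unique.
    replace (reduced_rhs_cert q l O) with (- (1) * - reduced_rhs_cert q l O) by ring.
    apply (is_series_ext (fun k => - (1) * (reduced_rhs_cert q l (S k) - reduced_rhs_cert q l k))).
    - intros k.
      change (- (1) * (reduced_rhs_cert q l (S k) - reduced_rhs_cert q l k) =
        reduced_rhs_term q l k + reduced_rhs_term q (S l) k + q ^ S l * reduced_rhs_term q (S (S l)) k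
        + 2 * sylvester_term q l (S k)).
      rewrite reduced_rhs_term_telescope by exact hq. ring.
    - apply (is_series_scal (V := C_NormedModule)). now apply is_series_telescope with B (Cmod q). }
  unfold rhs. subst P.
  transitivity (qpoch (- q) q l + qpoch (- q) q (S l) + q ^ S l * qpoch (- q) q (S (S l))
    + 2 * CSeries (fun k => sylvester_term q l (S k)) - reduced_rhs_cert q l O).
  { rewrite <- h. ring. }
  (* By [trunc_1], the boundary value equals (-q)_l - (-q)_(l+1) + q^(l+1) (-q)_(l+2); subtracting
     it leaves 2 (-q)_(l+1), the missing n = 0 term of 2 S(l+1). *)
  unfold reduced_rhs_cert. change (q ^ 0) with (RtoC 1). rewrite trunc_1 by exact hq.
  cbn [tri Nat.mul Nat.add]. rewrite !qpoch_S.
  pose proof (qpoch_neq_0 q l hq).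
  split_pow. change (qpoch q q 0) with (RtoC 1). field. assumption.
Qed.

(** The first four conjuncts ensure that the sums, the infinite product and the quotient in the last
    one have their intended meaning. *)
Theorem theorem4p10 (l : nat) (q : C) (hq : (Cmod q < 1)%R) :
  ex_series (sigma2_term l q) /\
  (exists P : C, is_Clim_seq (qpoch (- q) q) P) /\
  qpoch_inf (- q) q <> 0 /\
  ex_series (fun k : nat => rhs_term l q (S k)) /\
  sigma2 l q =
    1 / qpoch_inf (- q) q
    * (qpoch (- q) q l - CSeries (fun k : nat => rhs_term l q (S k))).
Proof.
  assert (hr : (0 <= Cmod q < 1)%R) by (split; [apply Cmod_ge_0 | exact hq]).
  destruct (term_bounds q hq) as [B hB].
  destruct (qpoch_limit q hq) as [P [B' [P0 [hP hPB]]]].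
  assert (hpow : forall (f : nat -> nat -> C) j k,
    (Cmod (f j k) <= B * Cmod q ^ (k + j) -> Cmod (f j k) <= B * Cmod q ^ j * Cmod q ^ k)%R).
  { intros f j k h. now rewrite Rmult_assoc, <- pow_add, Nat.add_comm. }
  assert (hs : forall j k, (Cmod (sigma2_term j q (S k)) <= B * Cmod q ^ j * Cmod q ^ k)%R)
    by (intros j k; apply (hpow (fun j k => sigma2_term j q (S k))), hB).
  assert (hE : forall j k, (Cmod (reduced_rhs_term q j k) <= B * Cmod q ^ j * Cmod q ^ k)%R)
    by (intros j k; apply (hpow (reduced_rhs_term q)), hB).
  assert (hexs' : forall j, ex_series (fun k => sigma2_term j q (S k)))
    by (intros j; now apply ex_series_of_geometric_bound with (B * Cmod q ^ j)%R (Cmod q)).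
  assert (hexs : forall j, ex_series (sigma2_term j q))
    by (intros j; now apply (ex_series_incr_1 (V := C_NormedModule))).
  assert (hexE : forall j, ex_series (reduced_rhs_term q j))
    by (intros j; now apply ex_series_of_geometric_bound with (B * Cmod q ^ j)%R (Cmod q)).
  set (rhs := fun j => qpoch (- q) q j - CSeries (reduced_rhs_term q j)).
  assert (hmain : P * sigma2 l q - rhs l = 0).
  (* [sylvester_series] takes one constant for three bounds, which come from [term_bounds] and
     [qpoch_limit]. *)
  { set (M := Rmax B B').
    assert (hM : forall (b : R) j, (b <= M -> b * Cmod q ^ j <= M * Cmod q ^ j)%R).
    { intros b j h. apply Rmult_le_compat_r; [apply pow_le; lra | exact h]. }
    pose proof (Rmax_l B B') as hM1. pose proof (Rmax_r B B') as hM2.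
    fold M in hM1, hM2.
    apply (recurrence_unique q (fun j => P * sigma2 j q - rhs j)
      (Cmod P * (B / (1 - Cmod q)) + (B' + B / (1 - Cmod q)))%R hq).
    - intros j.
      assert (hexA : ex_series (fun k => sylvester_term q j (S k))).
      { apply ex_series_of_geometric_bound with (B * Cmod q ^ j)%R (Cmod q); [exact hr|].
        intros k. apply (hpow (fun j k => sylvester_term q j (S k))), hB. }
      assert (hsyl : qpoch (- q) q (S j) + CSeries (fun k => sylvester_term q j (S k)) = P).
      { apply sylvester_series with M; [exact hq | | |].
        - intros i k. apply Rle_trans with (2 := hM B _ hM1). apply hB.
        - intros i k. apply Rle_trans with (2 := hM B _ hM1). apply hB.
        - intros i. apply Rle_trans with (2 := hM B' _ hM2). apply hPB. }
      assert (hRj : rhs j + rhs (S j) + q ^ S j * rhs (S (S j)) = 2 * P)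
        by (apply reduced_rhs_term_recurrence with B; auto; intros k; apply hB).
      transitivity (P * (sigma2 j q + sigma2 (S j) q + q ^ S j * sigma2 (S (S j)) q)
        - (rhs j + rhs (S j) + q ^ S j * rhs (S (S j)))); [ring|].
      rewrite hRj, sigma2_recurrence by assumption. ring.
    - intros j.
      assert (h0 : sigma2_term j q 0 = 1).
      { unfold sigma2_term. rewrite Nat.mul_0_r. simpl. field. }
      unfold sigma2, rhs. rewrite CSeries_incr_1, h0 by apply hexs.
      (* The n = 0 term of sigma contributes P, which pairs with (-q)_j; each of the three remaining
         pieces is O(|q|^j). *)
      replace (P * (1 + CSeries (fun k => sigma2_term j q (S k)))
          - (qpoch (- q) q j - CSeries (reduced_rhs_term q j)))
        with (P * CSeries (fun k => sigma2_term j q (S k))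
          + (- (qpoch (- q) q j - P) + CSeries (reduced_rhs_term q j))) by ring.
      rewrite !Rmult_plus_distr_r, Rmult_assoc.
      assert (hd : (B / (1 - Cmod q) * Cmod q ^ j = B * Cmod q ^ j / (1 - Cmod q))%R)
        by (unfold Rdiv; ring).
      rewrite hd. apply Cmod_plus_le; [apply Cmod_mult_le; [lra|]|apply Cmod_plus_le].
      + apply Cmod_series_le with (fun k => sigma2_term j q (S k)); auto.
        now apply CSeries_correct.
      + rewrite Cmod_opp. apply hPB.
      + apply Cmod_series_le with (reduced_rhs_term q j); auto. now apply CSeries_correct. }
  assert (hinf : qpoch_inf (- q) q = P) by now apply Clim_seq_unique.
  assert (hrhs : forall k, reduced_rhs_term q l k = rhs_term l q (S k))
    by (intros k; now rewrite rhs_term_S).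
  rewrite hinf, <- (CSeries_ext (reduced_rhs_term q l)) by auto.
  split; [apply hexs | split; [now exists P | split; [exact P0 | split]]].
  - now apply (ex_series_ext (reduced_rhs_term q l)).
  - fold (rhs l). replace (rhs l) with (P * sigma2 l q - (P * sigma2 l q - rhs l)) by ring.
    rewrite hmain. field. exact P0.
Qed.
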